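(* Suppose $\varepsilon,\delta>0$ and $G=H\rtimes_\phi K$ is a semidirect product of two countable groups $H,K$. If $H$ is abelian and $K$ has the $(\varepsilon,\delta)$-SAR property, then $G$ has the $(\varepsilon,\delta^2)$-SAR property.
   Context: ''Countable'' means in bijective correspondence with $\mathbb{N}$. Given a homomorphism $\phi:K\to\mathrm{Aut}(H)$, $k\mapsto\phi_k$, the semidirect product $H\rtimes_\phi K$ has underlying set $H\times K$ and operation $(h,k)(h',k')=(h\phi_k(h'),kk')$. A left Følner sequence in a countable group $L$ is a sequence $(F_N)_{N\in\mathbb{N}}$ of finite nonempty subsets of $L$ such that $\lim_{N\to\infty}\frac{|gF_N\Delta F_N|}{|F_N|}=0$ for all $g\in L$; $L$ is amenable if it has a left Følner sequence. A measure preserving system $(X,\mathcal{B},\mu,(T_g)_{g\in L})$ consists of a probability space $(X,\mathcal{B},\mu)$ and a left action of $L$ on $X$ by measure-preserving maps $T_g$, so that $T_{gh}=T_g\circ T_h$. For $\varepsilon,\delta>0$, a countable amenable group $L$ has the $(\varepsilon,\delta)$-SAR (Symmetric Averaging Recurrence) property if for all measure preserving systems $(X,\mathcal{B},\mu,(T_g)_{g\in L})$ and all $A\in\mathcal{B}$ with $\mu(A)\geq\varepsilon$, there exists a left Følner sequence $(F_N)$ in $L$ such that the limit $\lim_{N\to\infty}\frac{1}{|F_N|}\sum_{g\in F_N}\mu(T_g^{-1}A\cap T_gA)=\lim_{N\to\infty}\frac{1}{|F_N|}\sum_{g\in F_N}\mu(A\cap T_g^2A)$ exists and is $\geq\delta$.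 *)

(* Defs.v *)
From HB Require Import structures.
From mathcomp Require Import all_boot all_order all_algebra finmap.
From mathcomp Require Import all_classical all_reals all_analysis.

Set Implicit Arguments.
Unset Strict Implicit.
Unset Printing Implicit Defensive.

Import Order.TTheory GRing.Theory Num.Theory.
Import numFieldNormedType.Exports.

Local Open Scope classical_set_scope.
Local Open Scope ring_scope.

Definition countably_infinite (T : Type) : Prop :=
  ([set: T] #= [set: nat])%card.

Record automorphism (H : groupType) := Automorphism {
  aut_fun :> H -> H;
  aut_morph : {morph aut_fun : x y / (x * y)%g};
  aut_bij : bijective aut_fun
}.

HB.instance Definition _ (H : groupType) := gen_eqMixin (automorphism H).
HB.instance Definition _ (H : groupType) := gen_choiceMixin (automorphism H).

Section AutomorphismGroup.
Variable H : groupType.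
Implicit Types f g h : automorphism H.

Lemma autP f g : (forall x, f x = g x) -> f = g.
Proof.
case: f g => [f fM fB] [g gM gB] /= /funext fg.
by subst g; congr Automorphism; apply: Prop_irrelevance.
Qed.

Lemma aut_inverse_exists f :
  exists g : H -> H, cancel f g /\ cancel g f.
Proof. by case: (aut_bij f) => g fK gK; exists g. Qed.

Definition aut_inv_fun f : H -> H := projT1 (cid (aut_inverse_exists f)).

Lemma aut_funK f : cancel f (aut_inv_fun f).
Proof. by rewrite /aut_inv_fun; case: cid => g []. Qed.

Lemma aut_inv_funK f : cancel (aut_inv_fun f) f.
Proof. by rewrite /aut_inv_fun; case: cid => g []. Qed.

Lemma aut_inv_morph f : {morph aut_inv_fun f : x y / (x * y)%g}.
Proof.
move=> x y; apply: (can_inj (aut_funK f)).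
by rewrite aut_morph !aut_inv_funK.
Qed.

Lemma aut_inv_bij f : bijective (aut_inv_fun f).
Proof. by exists f; [exact: aut_inv_funK|exact: aut_funK]. Qed.

Definition aut_inv f : automorphism H :=
  Automorphism (aut_inv_morph f) (aut_inv_bij f).

Lemma aut_id_morph : {morph @id H : x y / (x * y)%g}.
Proof. by []. Qed.

Definition aut_one : automorphism H :=
  Automorphism aut_id_morph (inv_bij (fun=> erefl)).

Lemma aut_comp_morph f g : {morph f \o g : x y / (x * y)%g}.
Proof. by move=> x y; rewrite /= !aut_morph. Qed.

Definition aut_mul f g : automorphism H :=
  Automorphism (aut_comp_morph f g) (bij_comp (aut_bij f) (aut_bij g)).

Lemma aut_mulA : associative aut_mul.
Proof. by move=> f g h; apply: autP. Qed.

Lemma aut_mul1 : left_id aut_one aut_mul.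
Proof. by move=> f; apply: autP. Qed.

Lemma aut_mulr1 : right_id aut_one aut_mul.
Proof. by move=> f; apply: autP. Qed.

Lemma aut_mulV : left_inverse aut_one aut_inv aut_mul.
Proof. by move=> f; apply: autP => x /=; exact: aut_funK. Qed.

Lemma aut_mulrV : right_inverse aut_one aut_inv aut_mul.
Proof. by move=> f; apply: autP => x /=; exact: aut_inv_funK. Qed.

HB.instance Definition _ := isGroup.Build (automorphism H)
  aut_mulA aut_mul1 aut_mulr1 aut_mulV aut_mulrV.

End AutomorphismGroup.

(* The parameter phi is part of the type so that the group structure below
   can be inferred; it does not affect the carrier. *)
Definition semidirect (H K : groupType)
  (phi : {multiplicative K -> automorphism H}) : Type := (H * K)%type.

Section SemidirectProduct.
Variables (H K : groupType) (phi : {multiplicative K -> automorphism H}).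
Implicit Types p q : semidirect phi.

HB.instance Definition _ := Choice.copy (semidirect phi) (H * K)%type.

Definition sd_mul p q : semidirect phi :=
  ((p.1 * phi p.2 q.1)%g, (p.2 * q.2)%g).

Definition sd_one : semidirect phi := (1%g, 1%g).

Definition sd_inv p : semidirect phi :=
  ((phi (p.2^-1)%g (p.1^-1)%g), (p.2^-1)%g).

Lemma phiM k l x : phi (k * l)%g x = phi k (phi l x).
Proof. by rewrite gmulfM. Qed.

Lemma phi1 x : phi 1%g x = x.
Proof.
have [g fK _] := aut_bij (phi 1%g).
by apply: (can_inj fK); rewrite -phiM mul1g.
Qed.

Lemma phi_one k : phi k 1%g = 1%g.
Proof.
by apply: (@mulgI _ (phi k 1%g)); rewrite -aut_morph !mulg1.
Qed.

Lemma sd_mulA : associative sd_mul.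
Proof.
by move=> [h k] [h' k'] [h'' k'']; rewrite /sd_mul /= aut_morph phiM !mulgA.
Qed.

Lemma sd_mul1 : left_id sd_one sd_mul.
Proof. by move=> [h k]; rewrite /sd_mul /= phi1 !mul1g. Qed.

Lemma sd_mulr1 : right_id sd_one sd_mul.
Proof. by move=> [h k]; rewrite /sd_mul /= phi_one !mulg1. Qed.

Lemma sd_mulV : left_inverse sd_one sd_inv sd_mul.
Proof.
by move=> [h k]; rewrite /sd_mul /sd_inv /= -aut_morph !mulVg phi_one.
Qed.

Lemma sd_mulrV : right_inverse sd_one sd_inv sd_mul.
Proof.
by move=> [h k]; rewrite /sd_mul /sd_inv /= -phiM mulgV phi1 mulgV.
Qed.

HB.instance Definition _ := isGroup.Build (semidirect phi)
  sd_mulA sd_mul1 sd_mulr1 sd_mulV sd_mulrV.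

End SemidirectProduct.

Definition left_translate (L : groupType) (g : L) (F : {fset L}) : {fset L} :=
  [fset (g * x)%g | x in F]%fset.

Definition fsymdiff (T : choiceType) (A B : {fset T}) : {fset T} :=
  ((A `\` B) `|` (B `\` A))%fset.

Definition left_Folner (R : realType) (L : groupType) (F : nat -> {fset L}) :
    Prop :=
  (forall N, F N != fset0) /\
  forall g : L,
    (#|` fsymdiff (left_translate g (F N)) (F N)|%:R / #|` F N|%:R : R)
      @[N --> \oo] --> (0 : R).

Definition amenable (R : realType) (L : groupType) : Prop :=
  exists F : nat -> {fset L}, left_Folner R F.

Record measure_preserving_action (R : realType) (L : groupType)
    (d : measure_display) (X : measurableType d) (mu : probability X R)
    (T : L -> X -> X) : Prop := {
  action1 : forall x, T 1%g x = x;
  actionM : forall g h x, T (g * h)%g x = T g (T h x);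
  action_measurable : forall g, measurable_fun [set: X] (T g);
  action_preserving :
    forall g (B : set X), measurable B -> mu (T g @^-1` B) = mu B
}.

Definition average (R : realType) (L : choiceType) (F : {fset L})
    (u : L -> R) : R :=
  #|` F|%:R^-1 * \sum_(g <- F) u g.

(* Both averages are asked to converge to l, since T_g preserves mu they in
   fact agree term by term. The sets T_g A are measurable because T_g has the
   measurable inverse T_(g^-1), and mu is finite, so fine loses nothing. *)
Definition SAR (R : realType) (eps delta : R) (L : groupType) : Prop :=
  [/\ countably_infinite L,
      amenable R L &
      forall (d : measure_display) (X : measurableType d)
        (mu : probability X R) (T : L -> X -> X),
      measure_preserving_action mu T ->
      forall A : set X, measurable A -> (eps%:E <= mu A)%E ->
      exists (F : nat -> {fset L}) (l : R),
        [/\ left_Folner R F,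
            average (F N) (fun g => fine (mu (T g @^-1` A `&` T g @` A)))
              @[N --> \oo] --> l,
            average (F N) (fun g => fine (mu (A `&` (T g \o T g) @` A)))
              @[N --> \oo] --> l &
            delta <= l]].

(* Main.v *)
Require Import Defs.
From HB Require Import structures.
From mathcomp Require Import all_boot all_order all_algebra finmap.
From mathcomp Require Import all_classical all_reals all_analysis.
From mathcomp Require Import ring lra.

Set Implicit Arguments.
Unset Strict Implicit.
Unset Printing Implicit Defensive.

Import Order.TTheory GRing.Theory Num.Theory.
Import numFieldNormedType.Exports.

Local Open Scope classical_set_scope.
Local Open Scope ring_scope.

(** Write T for the action of G on X, A for the given set, and
   r g = mu (A `&` T (g * g) @` A).  The recurrence set in G is built from a
   Folner sequence E N of K adapted to A and to the restricted action of K,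
   so that the averages of r (1, k) over E N tend to some l >= delta.

   The Folner sets of G are the twisted products {(phi k h, k) | k in E N,
   h in Phi N}, that is {(1, k) (h, 1)}.  Putting the H-factor on the right
   matters: left translation by (h0, k0) sends (phi k h, k) to the pair with
   second coordinate k' = k0 k and H-factor phi k'^-1 h0 * h, so Phi N only has
   to be almost invariant under the finitely many elements phi k'^-1 h0 with
   k' in E N (lemma twisted_Folner).  Such Phi N exist because H is abelian:
   the boxes {g_1 ^ a_1 ... g_n ^ a_n | a_i <= M} grow polynomially in M, so
   some box is hardly larger than the preceding one.

   For the lower bound, g = (phi k h, k) has square (theta h, k * k), where
   theta h = phi k h * phi k (phi k h) is an endomorphism of the abelian group
   H.  Put C h = T (theta h, 1) @` (A `&` T (1, k * k) @` A), a set of measure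
   r (1, k).  Then r (phi k (h'^-1 * h), k) >= mu (C h' `&` C h), and summing
   over h, h' in Phi, the nonnegativity of the variance of the sum of the
   indicators of the C h gives
     sum_(h', h in Phi) r (phi k (h'^-1 * h), k) >= (#|Phi| * r (1, k)) ^ 2
   for every finite Phi and every k.  Summing over k in E as well, some single
   h' satisfies the averaged inequality, which says that replacing Phi by its
   translate h'^-1 Phi (equally invariant) makes
   the average of r over the twisted product at least the average over E of
   r (1, k) ^ 2, hence at least the square of the average of r (1, k).  This
   square tends to l ^ 2 >= delta ^ 2.  Finally the averages in G lie in [0, 1],
   and a subsequence of the Folner sequence makes them converge. *)

(** * Translates of finite sets *)

Lemma card_translate (L : groupType) (g : L) (F : {fset L}) :
  #|` left_translate g F| = #|` F|.
Proof. by apply: card_imfset; exact: mulgI. Qed.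

(** A finite set and its translate have the same size, so both halves of the
   symmetric difference do too; invariance can be measured by one half. *)
Lemma card_fsymdiff_translate (L : groupType) (g : L) (F : {fset L}) :
  #|` fsymdiff (left_translate g F) F| =
  (#|` left_translate g F `\` F|%fset).*2.
Proof.
set gF := left_translate g F.
have eqD : #|` F `\` gF|%fset = #|` gF `\` F|%fset.
  by rewrite !cardfsD card_translate fsetIC.
rewrite /fsymdiff cardfsU eqD -addnn.
suff -> : ((gF `\` F) `&` (F `\` gF) = fset0)%fset by rewrite cardfs0 subn0.
by apply/fsetP => x; rewrite !inE; case: (x \in F); rewrite ?andbF.
Qed.

Lemma card_translateD (L : groupType) (g : L) (F : {fset L}) :
  #|` left_translate g F `\` F|%fset = (\sum_(x <- F) (g * x \notin F)%g)%N.
Proof.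
have -> : (left_translate g F `\` F =
           [fset (g * x)%g | x in [fset x in F | (g * x \notin F)%g]])%fset.
  apply/fsetP => x; rewrite !inE; apply/andP/imfsetP => /=.
    by move=> [xF /imfsetP[y /= yF xE]]; exists y; rewrite // !inE yF -xE.
  by move=> [y /[!inE]/= /andP[yF gyF] ->]; rewrite in_imfset.
rewrite card_imfset; last exact: mulgI.
by rewrite card_fset_sum1 big_fset /= big_mkcond /=; apply: eq_bigr => x _; case: ifP.
Qed.

(** In an abelian group translating a set does not change how invariant it is;
   this gives the freedom to choose a translate later. *)
Lemma card_translateD_translate (L : groupType) (g c : L) (F : {fset L}) :
  (forall x y : L, x * y = y * x)%g ->
  #|` left_translate g (left_translate c F) `\` left_translate c F|%fset =
  #|` left_translate g F `\` F|%fset.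
Proof.
move=> comm; rewrite -[RHS](card_translate c); congr (#|` _|).
apply/fsetP => x; rewrite !inE; apply/andP/imfsetP => /=.
  move=> [xF /imfsetP[y /= /imfsetP[z /= zF ->] xE]].
  exists (g * z)%g; last by rewrite xE !mulgA (comm g).
  rewrite !inE in_imfset ?andbT//; apply: contra xF => gzF.
  by rewrite xE mulgA (comm g) -mulgA in_imfset.
move=> [y /[!inE]/andP[yF /imfsetP[z /= zF yE]] ->]; split.
  apply: contra yF => /imfsetP[w /= wF].
  by move/mulgI => ->.
by rewrite yE mulgA (comm c) -mulgA !in_imfset.
Qed.

(** * Almost invariant finite sets in abelian groups *)

Lemma exp_beats_pow (R : realType) (b : R) (n : nat) :
  1 < b -> exists M : nat, M.+1%:R ^+ n < b ^+ M.
Proof.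
move=> b1; have b0 : 0 < b by apply: lt_trans b1.
pose l := ln b; have l0 : 0 < l by rewrite ln_gt0.
(* b ^ M = expR (M * l) dominates the term (M * l) ^ n.+1 / n.+1`!, and
   M.+1 <= 2 * M, so that any M > C works. *)
pose C : R := 2 ^+ n * n.+1`!%:R / l ^+ n.+1.
have C0 : 0 <= C by rewrite /C !mulr_ge0 ?invr_ge0 ?exprn_ge0 ?ler0n ?(ltW l0).
pose M := (Num.truncn C).+1; exists M.
have CM : C < M%:R := truncnS_gt C.
have M0 : 0 < M%:R :> R by rewrite ltr0n.
have -> : b ^+ M = expR (M%:R * l) by rewrite expRM_natl lnK.
apply: lt_le_trans (expR_ge1Dxn n _); last by rewrite mulr_ge0 ?ltW.
apply: (@le_lt_trans _ _ ((2 * M%:R) ^+ n)).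
  rewrite lerXn2r ?nnegrE ?mulr_ge0 ?ler0n//.
  by rewrite -natrM ler_nat mul2n -addnn -addn1 leq_add2l.
rewrite ltr_pwDl// !exprMn.
rewrite [leLHS]mulrC [M%:R ^+ n.+1]exprSr -!mulrA ler_pM2l ?exprn_gt0//.
have -> : 2 ^+ n = C * (l ^+ n.+1 / n.+1`!%:R).
  by rewrite /C mulrA divfK ?expf_neq0 ?gt_eqF// mulfK//.
by rewrite ler_wpM2r ?ltW// divr_gt0 ?exprn_gt0 ?ltr0n ?fact_gt0.
Qed.

Section AbelianFolner.
Variables (L : groupType).
Hypothesis comm : forall x y : L, (x * y = y * x)%g.

Fixpoint box (s : seq L) (M : nat) : {fset L} :=
  if s is g :: s' then
    [fset x in [seq (g ^+ a * y)%g | a <- iota 0 M.+1, y <- box s' M]]%fset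
  else [fset 1%g]%fset.

Lemma boxS g s M : box (g :: s) M =
  [fset x in [seq (g ^+ a * y)%g | a <- iota 0 M.+1, y <- box s M]]%fset.
Proof. by []. Qed.

Lemma card_box s M : (#|` box s M| <= M.+1 ^ size s)%N.
Proof.
elim: s => [|g s IH]; first by rewrite /= cardfs1.
rewrite boxS card_fseq; apply: leq_trans (size_undup _) _.
by rewrite size_allpairs size_iota expnS leq_mul.
Qed.

Lemma boxP g s M x : reflect
  (exists a y, [/\ (a <= M)%N, y \in box s M & x = (g ^+ a * y)%g])
  (x \in box (g :: s) M).
Proof.
rewrite boxS in_fset; apply: (iffP allpairsP).
  by move=> [[a y] []]; rewrite mem_iota => aM yB ->; exists a, y.
move=> [a [y [aM yB ->]]]; exists (a, y); split=> //.
by rewrite mem_iota.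
Qed.

Lemma one_in_box s M : 1%g \in box s M.
Proof.
elim: s => [|g s IH]; first by rewrite /= inE.
by apply/boxP; exists 0%N, 1%g; rewrite expg0 mulg1.
Qed.

Lemma box_mono s M : (box s M `<=` box s M.+1)%fset.
Proof.
elim: s => [|g s IH]; first exact: fsubset_refl.
apply/fsubsetP => _ /boxP[a [y [aM yB ->]]].
by apply/boxP; exists a, y; rewrite leqW// (fsubsetP IH).
Qed.

Lemma box_translate s M g :
  g \in s -> (left_translate g (box s M) `<=` box s M.+1)%fset.
Proof.
move=> gs; apply/fsubsetP => _ /imfsetP[x /= xB ->].
elim: s gs x xB => // h s IH /[!inE]/orP[/eqP ->|gs] _ /boxP[a [y [aM yB ->]]].
  apply/boxP; exists a.+1, y; split; rewrite ?ltnS//.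
    exact: (fsubsetP (box_mono s M)).
  by rewrite expgS mulgA.
apply/boxP; exists a, (g * y)%g; split; [exact: leqW|exact: IH|].
by rewrite !mulgA (comm g).
Qed.

(** Translation by an element of s sends the box of side M into that of side
   M + 1.  If every box were larger than the preceding one by a factor
   1 + eta, box sizes would grow exponentially, against card_box. *)
Lemma abelian_almost_invariant (R : realType) (s : seq L) (eta : R) :
  0 < eta -> exists F : {fset L}, F != fset0 /\ forall g, g \in s ->
    #|` left_translate g F `\` F|%fset%:R <= eta * #|` F|%:R.
Proof.
move=> eta0; pose u M : R := #|` box s M|%:R.
have [M uM] : exists M, u M.+1 <= (1 + eta) * u M.
  apply: contrapT => /forallNP ugt.
  have ub M : (1 + eta) ^+ M <= u M.
    elim: M => [|M IH].
      by rewrite expr0 ler1n cardfs_gt0; apply/fset0Pn; exists 1%g; exact: one_in_box.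
    rewrite exprS; apply: (@le_trans _ _ ((1 + eta) * u M)).
      by rewrite ler_pM2l// ltr_wpDr// ltW.
    by have /negP := ugt M; rewrite -ltNge => /ltW.
  have [|M] := @exp_beats_pow R (1 + eta) (size s); first by rewrite ltrDl.
  by apply/negP; rewrite -leNgt (le_trans (ub M))// -natrX ler_nat card_box.
exists (box s M); split.
  by apply/fset0Pn; exists 1%g; exact: one_in_box.
move=> g gs; apply: (@le_trans _ _ #|` box s M.+1 `\` box s M|%fset%:R).
  rewrite ler_nat; apply: fsubset_leq_card.
  by apply: fsetSD; exact: box_translate.
rewrite cardfsDS ?box_mono// natrB ?fsubset_leq_card ?box_mono//.
by rewrite lerBlDl -[X in X + _]mul1r -mulrDl.
Qed.

End AbelianFolner.

(** * Finite averages *)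

Lemma sumr_seq_const (V : nmodType) (I : Type) (r : seq I) (x : V) :
  \sum_(i <- r) x = x *+ size r.
Proof. by rewrite big_const_seq count_predT iter_addr_0. Qed.

Lemma sum_pigeonhole (R : realType) (I : eqType) (r : seq I) (u : I -> R) (a : R) :
  (0 < size r)%N -> (size r)%:R * a <= \sum_(i <- r) u i ->
  exists2 i, i \in r & a <= u i.
Proof.
move=> r0 le_sum; apply: contrapT => nex.
have lt_a i : i \in r -> u i < a.
  by move=> ir; rewrite ltNge; apply/negP => au; apply: nex; exists i.
move: le_sum; apply/negP; rewrite -ltNge.
case: r r0 lt_a {nex} => // i r _ lt_a.
rewrite big_cons [size _]/= -natr1 mulrDl mul1r [ltRHS]addrC.
apply: ltr_leD; first by rewrite lt_a ?mem_head.
rewrite mulr_natl -sumr_seq_const [leLHS]big_seq [leRHS]big_seq.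
by apply: ler_sum => j jr; rewrite ltW// lt_a// inE jr orbT.
Qed.

Lemma sqr_average_le (R : realType) (L : choiceType) (F : {fset L}) (u : L -> R) :
  F != fset0 -> average F u ^+ 2 <= average F (fun x => u x ^+ 2).
Proof.
rewrite -cardfs_gt0 => F0; set m := average F u.
have nF : #|` F|%:R != 0 :> R by rewrite pnatr_eq0 -lt0n.
have sumE : \sum_(x <- F) u x = #|` F|%:R * m by rewrite /m /average mulrA mulfV ?mul1r.
have : 0 <= \sum_(x <- F) (u x - m) ^+ 2 by apply: sumr_ge0 => x _; exact: sqr_ge0.
have -> : \sum_(x <- F) (u x - m) ^+ 2 =
    \sum_(x <- F) u x ^+ 2 - #|` F|%:R * m ^+ 2.
  transitivity (\sum_(x <- F) u x ^+ 2 + \sum_(x <- F) (- 2 * m) * u x +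
                \sum_(x <- F) m ^+ 2).
    by rewrite -!big_split /=; apply: eq_bigr => x _; ring.
  by rewrite -mulr_sumr sumE sumr_seq_const -mulr_natl; ring.
rewrite subr_ge0 => le_sum; rewrite /average mulrC ler_pdivlMr ?ltr0n//.
by rewrite mulrC.
Qed.

Lemma average_bounds (R : realType) (L : choiceType) (F : {fset L}) (u : L -> R) :
  (forall x, 0 <= u x <= 1) -> 0 <= average F u <= 1.
Proof.
move=> u01; have u0 x : 0 <= u x by have /andP[] := u01 x.
rewrite /average mulr_ge0 ?invr_ge0 ?sumr_ge0//=.
have [->|F0] := eqVneq F fset0; first by rewrite big_seq_fset0 mulr0.
rewrite ler_pdivrMl ?ltr0n ?cardfs_gt0// mulr1 -sumr_seq_const.
by apply: ler_sum => x _; have /andP[] := u01 x.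
Qed.

(** * Twisted products as Folner sets of the semidirect product *)

Section TwistedProduct.
Variables (H K : groupType) (phi : {multiplicative K -> automorphism H}).

(** The product set {(1, k) (h, 1)}, with the H-factor on the right. *)
Definition twisted (E : {fset K}) (Phi : {fset H}) : {fset semidirect phi} :=
  [fset ((phi k h, k) : semidirect phi) | k in E, h in Phi]%fset.

Lemma aut_cancel k : cancel (phi k) (phi k^-1%g).
Proof. by move=> h; rewrite -phiM mulVg phi1. Qed.

Lemma aut_cancelV k : cancel (phi k^-1%g) (phi k).
Proof. by move=> h; rewrite -phiM mulgV phi1. Qed.

Lemma sd_mulE h k h' k' :
  (((h, k) : semidirect phi) * ((h', k') : semidirect phi))%g =
  ((h * phi k h', k * k')%g : semidirect phi).
Proof. by []. Qed.

Lemma big_twisted (V : Type) (idx : V) (op : Monoid.com_law idx) E Phi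
    (u : semidirect phi -> V) :
  \big[op/idx]_(g <- twisted E Phi) u g =
  \big[op/idx]_(k <- E) \big[op/idx]_(h <- Phi) u (phi k h, k).
Proof.
rewrite big_imfset2// => -[k h] [k' h'] _ _ /= [] + kE.
by subst k' => /(can_inj (aut_cancel k)) ->.
Qed.

Lemma card_twisted E Phi : #|` twisted E Phi| = (#|` E| * #|` Phi|)%N.
Proof.
rewrite card_fset_sum1 big_twisted.
under eq_bigr do rewrite sum1_size.
by rewrite big_const_seq count_predT iter_addn_0 mulnC.
Qed.

Lemma mem_twisted E Phi k h :
  (((h, k) : semidirect phi) \in twisted E Phi) =
  (k \in E) && (phi k^-1%g h \in Phi).
Proof.
apply/imfset2P/andP => /= [[k' k'E [h' h'Phi [-> ->]]]|[kE hPhi]].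
  by rewrite aut_cancel.
by exists k => //; exists (phi k^-1%g h); rewrite // aut_cancelV.
Qed.

(** A translate of (phi k h, k) leaves the twisted product either because k0 k
   leaves E, or because k0 k stays in E and phi (k0 k)^-1 h0 moves h out of
   Phi. *)
Lemma twisted_translateD_le (R : realType) E Phi (h0 : H) (k0 : K) (eta : R) :
  0 <= eta ->
  (forall k, k \in E ->
     #|` left_translate (phi k^-1%g h0) Phi `\` Phi|%fset%:R <= eta * #|` Phi|%:R) ->
  #|` left_translate ((h0, k0) : semidirect phi) (twisted E Phi)
        `\` twisted E Phi|%fset%:R <=
  (#|` left_translate k0 E `\` E|%fset%:R + eta * #|` E|%:R) * #|` Phi|%:R :> R.
Proof.
move=> eta0 Phi_inv; rewrite !card_translateD (@big_twisted _ _ addn) !natr_sum.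
have -> : (\sum_(k <- E) (k0 * k \notin E)%g%:R + eta * #|` E|%:R) * #|` Phi|%:R =
    \sum_(k <- E) ((k0 * k \notin E)%g%:R * #|` Phi|%:R + eta * #|` Phi|%:R) :> R.
  rewrite big_split sumr_seq_const /= -mulr_suml mulrDl.
  by congr (_ + _); rewrite -[RHS]mulr_natr mulrAC.
apply: ler_sum => k _; rewrite natr_sum.
have [kE|kNE] := boolP (k0 * k \in E)%g.
  rewrite mul0r add0r; apply: le_trans (Phi_inv _ kE); rewrite card_translateD natr_sum.
  apply: ler_sum => h _; rewrite ler_nat.
  rewrite sd_mulE.
  by rewrite -phiM mem_twisted kE /= aut_morph aut_cancel.
rewrite mul1r -[leLHS]addr0 lerD ?mulr_ge0//.
rewrite -sumr_seq_const; apply: ler_sum => h _; rewrite -[1]/(1%:R) ler_nat.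
exact: leq_b1.
Qed.

Lemma twisted_Folner (R : realType) (E : nat -> {fset K}) (Phi : nat -> {fset H}) :
  left_Folner R E -> (forall N, Phi N != fset0) ->
  (forall h : H, \forall N \near \oo, forall k, k \in E N ->
     #|` left_translate (phi k^-1%g h) (Phi N) `\` Phi N|%fset%:R <=
       N.+1%:R^-1 * #|` Phi N|%:R :> R) ->
  left_Folner R (fun N => twisted (E N) (Phi N)).
Proof.
move=> [En0 Einv] Phin0 Phiinv; split=> [N|[h0 k0]].
  by rewrite -cardfs_gt0 card_twisted muln_gt0 !cardfs_gt0 En0 Phin0.
pose b N : R := #|` fsymdiff (left_translate k0 (E N)) (E N)|%:R / #|` E N|%:R +
  2 * N.+1%:R^-1.
have b0 : b N @[N --> \oo] --> (0 : R).
  rewrite -[X in _ --> X](addr0 0) -[X in _ --> _ + X](mulr0 2).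
  apply: cvgD; first exact: Einv.
  by apply: cvgM; [exact: cvg_cst|exact: cvg_harmonic].
apply: (squeeze_cvgr _ (cvg_cst 0) b0).
near=> N; rewrite divr_ge0//=.
have EN : 0 < #|` E N|%:R :> R by rewrite ltr0n cardfs_gt0.
have PhiN : 0 < #|` Phi N|%:R :> R by rewrite ltr0n cardfs_gt0.
rewrite card_twisted natrM ler_pdivrMr ?mulr_gt0// /b !card_fsymdiff_translate.
rewrite -!muln2 !natrM.
set dE : R := #|` left_translate k0 (E N) `\` E N|%fset%:R.
have -> : (dE * 2 / #|` E N|%:R + 2 * N.+1%:R^-1) * (#|` E N|%:R * #|` Phi N|%:R) =
    (dE + N.+1%:R^-1 * #|` E N|%:R) * #|` Phi N|%:R * 2.
  by field; rewrite nat1r pnatr_eq0 lt0r_neq0.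
rewrite ler_pM2r//; apply: twisted_translateD_le; first by rewrite invr_ge0.
by near: N; exact: Phiinv.
Unshelve. all: by end_near.
Qed.

End TwistedProduct.

(** * Countability, and Folner sets in the abelian factor *)

Lemma countably_infinite_semidirect (H K : groupType)
    (phi : {multiplicative K -> automorphism H}) :
  countably_infinite H -> countably_infinite K ->
  countably_infinite (semidirect phi).
Proof.
rewrite /countably_infinite => cH cK.
have -> : [set: semidirect phi] = [set: H] `*`` (fun=> [set: K]).
  by apply/seteqP; split.
apply: cardXR_eq_nat => // h; split; last by exists 1%g.
by move: cK; rewrite card_eq_le => /andP[].
Qed.

Lemma countably_infinite_enum (T : Type) :
  countably_infinite T -> exists e : nat -> T, forall x, exists n, e n = x.
Proof.
move=> /card_set_bijP[f [_ finj fsurj]].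
have /choice[e eP] : forall n, exists x, f x = n.
  by move=> n; have [x _ fx] := fsurj n I; exists x.
by exists e => x; exists (f x); apply: finj; rewrite ?inE.
Qed.

(** Enumerating H makes the finitely many constraints at stage N exhaust all h
   eventually. *)
Lemma abelian_Folner_twists (R : realType) (H K : groupType)
    (phi : {multiplicative K -> automorphism H}) (E : nat -> {fset K}) :
  countably_infinite H -> (forall x y : H, x * y = y * x)%g ->
  exists Phi : nat -> {fset H}, (forall N, Phi N != fset0) /\
    forall h : H, \forall N \near \oo, forall k, k \in E N ->
     #|` left_translate (phi k^-1%g h) (Phi N) `\` Phi N|%fset%:R <=
       N.+1%:R^-1 * #|` Phi N|%:R :> R.
Proof.
move=> /countably_infinite_enum[e e_surj] comm.
have /choice[Phi PhiP] : forall N, exists F : {fset H}, F != fset0 /\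
    forall g, g \in [seq phi k^-1%g (e i) | i <- iota 0 N.+1, k <- E N] ->
    #|` left_translate g F `\` F|%fset%:R <= N.+1%:R^-1 * #|` F|%:R :> R.
  by move=> N; apply: abelian_almost_invariant; rewrite ?invr_gt0.
exists Phi; split=> [N|h]; first by have [] := PhiP N.
have [n <-] := e_surj h; exists n => // N /= nN k kE.
have [_] := PhiP N; apply.
by apply: (allpairs_f (fun i k => phi k^-1%g (e i))); rewrite ?mem_iota.
Qed.

(** * Correlations of events *)

(** With Y the sum of the indicators of the C i and c its expectation, this is
   the nonnegativity of the expectation of (Y - c) ^ 2. *)
Lemma sum_measure_setI_ge (R : realType) (d : measure_display)
    (X : measurableType d) (P : probability X R) (I : Type) (r : seq I)
    (C : I -> set X) : (forall i, measurable (C i)) ->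
  (\sum_(i <- r) fine (P (C i))) ^+ 2 <=
  \sum_(i <- r) \sum_(j <- r) fine (P (C i `&` C j)).
Proof.
move=> mC; pose c := \sum_(i <- r) fine (P (C i)).
have Lfun_indic (A : set X) : measurable A -> (\1_A : X -> R) \in Lfun P 1.
  by move=> mA; apply/Lfun1_integrable; apply: integrable_indic.
have E_indic (I' : Type) (r' : seq I') (D : I' -> set X) :
    (forall i, measurable (D i)) ->
    (\sum_(i <- r') (\1_(D i) : X -> R)) \in Lfun P 1 /\
    ('E_P[(\sum_(i <- r') \1_(D i))%R] = (\sum_(i <- r') fine (P (D i)))%R%:E)%E.
  move=> mD; elim: r' => [|i r' [IH1 IH2]].
    by rewrite !big_nil expectation_cst; split => //; exact: Lfun_cst.
  rewrite !big_cons; split; first by rewrite rpredD ?Lfun_indic.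
  rewrite expectationD ?Lfun_indic// IH2 expectation_indic//.
  by rewrite EFinD fineK// fin_num_measure.
have [LY EY] := E_indic _ r C mC.
set Y := \sum_(i <- r) _ in LY EY.
have [] := E_indic _ [seq (i, j) | i <- r, j <- r] (fun p => C p.1 `&` C p.2).
  by move=> p; exact: measurableI.
rewrite !big_allpairs; set Z := \sum_(i <- r) \sum_(j <- r) _ => LZ EZ.
have ZE x : Z x = Y x ^+ 2.
  rewrite /Z /Y !fct_sumE expr2 mulr_suml; apply: eq_bigr => i _.
  by rewrite fct_sumE mulr_sumr; apply: eq_bigr => j _; rewrite indicI.
have : (0 <= 'E_P[((Z \+ (- 2 * c) \o* Y) \+ cst (c ^+ 2))%R])%E.
  apply: expectation_ge0 => x /=.
  rewrite ZE [leRHS](_ : _ = (Y x - c) ^+ 2); first exact: sqr_ge0.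
  by ring.
have LcY : (- 2 * c) \o* Y \in Lfun P 1 by exact: (@Lfun_scale _ _ _ _ _ _ 1).
rewrite expectationD ?expectation_cst ?expectationD ?expectationZl//; last 2 first.
- exact: rpredD.
- exact: Lfun_cst.
rewrite EZ EY -EFinM -!EFinD lee_fin /= -/c; nra.
Qed.

(** * Square recurrence along an action *)

Section Action.
Variables (R : realType) (L : groupType) (d : measure_display).
Variables (X : measurableType d) (mu : probability X R) (T : L -> X -> X).
Hypothesis act : measure_preserving_action mu T.

Lemma action_cancel g : cancel (T g) (T g^-1%g).
Proof. by move=> x; rewrite -(actionM act) mulVg (action1 act). Qed.

Lemma action_cancelV g : cancel (T g^-1%g) (T g).
Proof. by move=> x; rewrite -(actionM act) mulgV (action1 act). Qed.

Lemma action_image g (A : set X) : T g @` A = T g^-1%g @^-1` A.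
Proof.
apply/seteqP; split=> [_ [x Ax <-]|x Ax] /=; first by rewrite action_cancel.
by exists (T g^-1%g x); rewrite // action_cancelV.
Qed.

Lemma action_imageM g h (A : set X) : T g @` (T h @` A) = T (g * h)%g @` A.
Proof.
by rewrite image_comp; apply: eq_imagel => x _; rewrite /= (actionM act).
Qed.

Lemma measurable_action_image g (A : set X) :
  measurable A -> measurable (T g @` A).
Proof.
move=> mA; rewrite action_image -[X in measurable X]setTI.
exact: (action_measurable act).
Qed.

Lemma measure_action_image g (A : set X) :
  measurable A -> mu (T g @` A) = mu A.
Proof. by move=> mA; rewrite action_image (action_preserving act). Qed.

Lemma action_imageI g (A B : set X) :
  T g @` (A `&` B) = T g @` A `&` T g @` B.
Proof. by rewrite !action_image. Qed.

Definition square_recurrence (A : set X) (g : L) : R :=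
  fine (mu (A `&` (T g \o T g) @` A)).

Lemma square_recurrenceE A g :
  square_recurrence A g = fine (mu (A `&` T (g * g)%g @` A)).
Proof. by rewrite /square_recurrence -image_comp action_imageM. Qed.

(** Apply the measure-preserving map T g to the left-hand set. *)
Lemma square_recurrence_sym A g : measurable A ->
  fine (mu (T g @^-1` A `&` T g @` A)) = square_recurrence A g.
Proof.
move=> mA; rewrite square_recurrenceE; congr fine.
have gA : T g @^-1` A = T g^-1%g @` A by rewrite action_image invgK.
rewrite -[LHS](measure_action_image g); last first.
  by apply: measurableI; rewrite ?gA; exact: measurable_action_image.
rewrite action_imageI gA !action_imageM mulgV; congr (mu (_ `&` _)).
by rewrite (eq_imagel (fun x _ => action1 act x)) image_id.
Qed.

Lemma square_recurrence_bounds A g : measurable A ->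
  0 <= square_recurrence A g <= 1.
Proof.
move=> mA; rewrite square_recurrenceE fine_ge0//=.
have mI : measurable (A `&` T (g * g)%g @` A).
  by apply: measurableI => //; exact: measurable_action_image.
by rewrite -lee_fin fineK ?fin_num_measure ?probability_le1.
Qed.

End Action.

(** * The lower bound on the semidirect product *)

Section Semidirect.
Variables (R : realType) (H K : groupType).
Variables (phi : {multiplicative K -> automorphism H}).
Variables (d : measure_display) (X : measurableType d) (mu : probability X R).
Variable T : semidirect phi -> X -> X.
Hypothesis comm : forall x y : H, (x * y = y * x)%g.
Hypothesis act : measure_preserving_action mu T.
Variable A : set X.
Hypothesis mA : measurable A.

Notation r g := (square_recurrence mu T A g).

Lemma restricted_action :
  measure_preserving_action mu (fun k : K => T (1%g, k)).
Proof.
case: act => a1 aM am ap; split.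
- exact: a1.
- by move=> k l x; rewrite -aM sd_mulE phi_one mulg1.
- by move=> k; exact: am.
- by move=> k B; exact: ap.
Qed.

(** With theta and C as in the proof, the sets C h all have measure r (1, k).  Moving A `&` T (g * g) @` A by
   T (theta h', 1), where g = (phi k (h'^-1 * h), k), gives a set containing
   C h' `&` C h, because theta is a morphism, H being abelian. *)
Lemma sum_square_recurrence_fiber (Phi : {fset H}) (k : K) :
  (#|` Phi|%:R * r (1%g, k)) ^+ 2 <=
  \sum_(h' <- Phi) \sum_(h <- Phi) r (phi k (h'^-1 * h)%g, k).
Proof.
pose theta h := (phi k h * phi k (phi k h))%g.
pose B := A `&` T (1%g, (k * k)%g) @` A.
have mB : measurable B.
  by apply: measurableI => //; exact: (measurable_action_image act).
pose C h := T (theta h, 1%g) @` B.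
have mC h : measurable (C h) by exact: (measurable_action_image act).
have muC h : fine (mu (C h)) = r (1%g, k).
  by rewrite (measure_action_image act)// (square_recurrenceE act) sd_mulE phi_one mulg1.
have := @sum_measure_setI_ge _ _ _ mu _ Phi C mC.
under eq_bigr do rewrite muC.
rewrite sumr_seq_const -[_ *+ _]mulr_natl => /le_trans; apply.
apply: ler_sum => h' _; apply: ler_sum => h _.
pose g : semidirect phi := (phi k (h'^-1 * h)%g, k).
have thetaM x y : theta (x * y)%g = (theta x * theta y)%g.
  by rewrite /theta !aut_morph -!mulgA; congr (_ * _)%g; rewrite !mulgA (comm (phi k y)).
have gg : (((theta h', 1) : semidirect phi) * (g * g))%g =
    (((theta h, 1) : semidirect phi) * ((1, k * k) : semidirect phi))%g.
  rewrite !sd_mulE !phi1 !mul1g mulg1 -/(theta (h'^-1 * h)%g) -thetaM.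
  by rewrite mulVKg.
rewrite (square_recurrenceE act) -/g.
have mgA : measurable (A `&` T (g * g)%g @` A).
  by apply: measurableI => //; exact: (measurable_action_image act).
rewrite -(measure_action_image act ((theta h', 1%g) : semidirect phi) mgA).
have mC2 : measurable (C h' `&` C h) by exact: measurableI.
have mTgA := measurable_action_image act ((theta h', 1%g) : semidirect phi) mgA.
apply: fine_le; rewrite ?fin_num_measure//.
apply: le_measure; rewrite ?inE//.
rewrite (action_imageI act) (action_imageM act) gg -(action_imageM act).
by apply: setISS; apply: image_subset; [exact: subIsetl|exact: subIsetr].
Qed.

(** The translate is by c = h'^-1 for some h' in Phi, chosen by averaging the
   fiber inequality summed over k; it therefore serves all k in E at once. *)
Lemma average_square_recurrence_ge (E : {fset K}) (Phi : {fset H}) :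
  E != fset0 -> Phi != fset0 ->
  exists c : H,
    average E (fun k => r (1%g, k)) ^+ 2 <=
    average (twisted phi E (left_translate c Phi)) (fun g => r g).
Proof.
move=> E0 Phi0; pose m k := r (1%g, k).
have E_gt0 : 0 < #|` E|%:R :> R by rewrite ltr0n cardfs_gt0.
have Phi_gt0 : 0 < #|` Phi|%:R :> R by rewrite ltr0n cardfs_gt0.
have [||c cPhi le_c] := @sum_pigeonhole R H Phi
    (fun c => \sum_(k <- E) \sum_(h <- Phi) r (phi k (c^-1 * h)%g, k))
    (#|` Phi|%:R * \sum_(k <- E) m k ^+ 2).
- by rewrite cardfs_gt0.
- rewrite exchange_big mulrA mulr_sumr /=; apply: ler_sum => k _.
  by rewrite -expr2 -exprMn; exact: sum_square_recurrence_fiber.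
exists (c^-1)%g; apply: le_trans (sqr_average_le m E0) _.
rewrite /average card_twisted card_translate natrM big_twisted.
rewrite invfM -mulrA ler_pM2l ?invr_gt0// ler_pdivlMl//.
apply: le_trans le_c _; apply: ler_sum => k _.
by rewrite big_imfset//= => x y _ _; exact: mulgI.
Qed.

End Semidirect.

(** * The transfer of symmetric averaging recurrence *)

Theorem theorem1p31 (R : realType) (eps delta : R) (H K : groupType)
    (phi : {multiplicative K -> automorphism H})
    (eps_gt0 : 0 < eps) (delta_gt0 : 0 < delta)
    (countable_H : countably_infinite H) (countable_K : countably_infinite K)
    (abelian_H : forall x y : H, (x * y = y * x)%g)
    (SAR_K : SAR eps delta K) :
  SAR eps (delta ^+ 2) (semidirect phi).
Proof.
have [_ [E0 E0_Folner] SAR_action] := SAR_K; split.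
- exact: countably_infinite_semidirect.
- have [Phi [Phi0 Phi_inv]] := abelian_Folner_twists R phi E0 countable_H abelian_H.
  by exists (fun N => twisted phi (E0 N) (Phi N)); exact: twisted_Folner.
move=> d X mu T act A mA epsA.
have [E [l [E_Folner _ E_cvg delta_l]]] :=
  SAR_action d X mu _ (restricted_action act) A mA epsA.
have [Phi [Phi0 Phi_inv]] := abelian_Folner_twists R phi E countable_H abelian_H.
pose r := square_recurrence mu T A.
have /choice[c cP] : forall N, exists c,
    average (E N) (fun k => r (1%g, k)) ^+ 2 <=
    average (twisted phi (E N) (left_translate c (Phi N))) r.
  by move=> N; apply: average_square_recurrence_ge => //; case: E_Folner.
pose F N := twisted phi (E N) (left_translate (c N) (Phi N)).
have F_Folner : left_Folner R F.
  apply: twisted_Folner => // [N|h].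
    by rewrite -cardfs_gt0 card_translate cardfs_gt0.
  have := Phi_inv h; apply: filterS => N + k kE => /(_ k kE).
  by rewrite card_translateD_translate// card_translate.
pose u N := average (F N) r.
have u_bound N : 0 <= u N <= 1.
  by apply: average_bounds => g; exact: square_recurrence_bounds.
have [s s_mono /cvg_ex[l' u_cvg]] :
    exists2 s : nat -> nat, increasing_seq s & cvgn (u \o s).
  apply: bolzano_weierstrass; exists 1; split=> // x x1 N _ /=.
  have /andP[u0 u1] := u_bound N.
  by rewrite ger0_norm// (le_trans u1)// ltW.
(* An increasing sequence of integers dominates its index. *)
have s_cvg : s N @[N --> \oo] --> \oo.
  apply/cvgnyPge => M; exists M => // N /= MN; apply: leq_trans MN _.
  elim: N => // N IH; apply: leq_ltn_trans IH _.
  by have := leqW_mono s_mono N N.+1; rewrite ltnSn.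
exists (F \o s), l'; split.
- case: F_Folner => F0 F_inv; split=> [N|g]; first exact: F0.
  exact: (cvg_comp _ _ s_cvg (F_inv g)).
- rewrite (_ : (fun N => _) = u \o s)//; apply/funext => N /=; congr (_ * _).
  by apply: eq_bigr => g _; rewrite (square_recurrence_sym act).
- exact: u_cvg.
apply: (@le_trans _ _ (l ^+ 2)).
  by rewrite lerXn2r ?nnegrE// ltW// (lt_le_trans delta_gt0).
have El_cvg : average (E (s N)) (fun k => r (1%g, k)) ^+ 2 @[N --> \oo] --> l ^+ 2.
  rewrite expr2; apply: cvgM; exact: (cvg_comp _ _ s_cvg E_cvg).
apply: ler_cvg_to El_cvg u_cvg _.
by apply: nearW => N; exact: cP.
Qed.
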